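(* For $n\ge1$, the polynomial $D_n(q)=\sum_{\pi\in\mathfrak S_n}q^{b(\pi)}$ satisfies $$\deg D_n(q)=\left\lfloor\frac{n^2}{4}\right\rfloor,$$ $$[q^{\lfloor n^2/4\rfloor}]D_n(q)=\begin{cases}n,&n\text{ odd},\\ n/2,&n\text{ even},\end{cases}$$ $$\frac{D_n'(1)}{n!}=(n+1)H_n-2n,$$ where $H_n=\sum_{j=1}^n 1/j$ and $[q^m]D_n(q)$ denotes the coefficient of $q^m$ in $D_n(q)$.
   Context: $\mathfrak S_n$ is the set of permutations $\pi=\pi_1\cdots\pi_n$ of $\{1,\dots,n\}$. An occurrence of the boxed pattern $\mathrm{Box}(12)$ in $\pi$ is a pair of positions $i<j$ with $\pi_i<\pi_j$ such that no $k$ with $i<k<j$ satisfies $\pi_i<\pi_k<\pi_j$; $b(\pi)$ is the number of such occurrences. *)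

(* Defs.v *)
From HB Require Import structures.
From mathcomp Require Import all_boot all_order all_algebra all_fingroup.
Set Implicit Arguments.
Unset Strict Implicit.
Unset Printing Implicit Defensive.
Import Order.TTheory GRing.Theory Num.Theory.
Local Open Scope ring_scope.

(* Positions and values are shifted to {0, ..., n-1}; only their relative
   order matters. *)
Definition box12_occ (n : nat) (s : 'S_n) (i j : 'I_n) : bool :=
  [&& (i < j)%N, (s i < s j)%N &
      ~~ [exists k : 'I_n, (i < k < j)%N && (s i < s k < s j)%N]].

Definition box12_count (n : nat) (s : 'S_n) : nat :=
  #|[set ij : 'I_n * 'I_n | box12_occ s ij.1 ij.2]|.

(* The coefficients are natural numbers; rat is used because D_n'(1) / n! is
   not an integer in general. *)
Definition boxD (n : nat) : {poly rat} := \sum_(s : 'S_n) 'X^(box12_count s).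

Definition harmonic (n : nat) : rat := \sum_(1 <= j < n.+1) j%:R^-1.

(* Main.v *)
Require Import Defs.
From HB Require Import structures.
From mathcomp Require Import all_boot all_order all_algebra all_fingroup.
From mathcomp Require Import zify ring.
Set Implicit Arguments.
Unset Strict Implicit.
Unset Printing Implicit Defensive.
Import Order.TTheory GRing.Theory Num.Theory.
Local Open Scope nat_scope.

(** An occurrence of the boxed pattern 12 in [s] is a covering pair of the
    two-dimensional order in which [x] lies below [y] when [x < y] and
    [s x < s y].  So [box12_count s] is the number of edges of a Hasse diagram.

    Degree and leading coefficient.  A Hasse diagram has no triangle: of three
    pairwise comparable elements, the middle one separates the outer two.  Hence
    Mantel's bound [n ^ 2 %/ 4] applies, and a diagram that attains it is a
    balanced complete bipartite graph ([triangle_free_degree_sum]).  Let [A] be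
    the side that does not contain position 0, which is a minimal element.  Every
    element of [A] covers 0, and every other element turns out to lie below all
    of [A] or above all of [A].  This makes [s] a sum of three decreasing blocks
    whose middle block is [A] ([extremal_layers]); conversely all such sums with
    a balanced middle block are extremal ([layered_extremal]).  It remains to
    count the pairs of break points.  The first block is nonempty, since it
    contains position 0, which makes the pair of break points unique; for odd [n]
    there are [n] of them, for even [n] there are [n./2]
    ([card_extremal_perms]).

    Mean.  By linearity, the mean of [box12_count] is the sum over [i < j] of the
    probability that [(i, j)] is an occurrence, that is, that [s j] directly
    follows [s i] among the values of [s] on the [j.+1 - i] positions from [i] to
    [j].  In a window [W], each permutation has [#|W|.-1] pairs of positions with
    consecutive values, and by symmetry they are equally likely to sit at each of
    the [#|W| * #|W|.-1] ordered pairs of distinct positions, so this probability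
    is [1 / #|W|] ([card_succ_in]).  Summing [1 / (j.+1 - i)] gives the harmonic
    expression. *)

(** * Extremal triangle-free graphs *)

Lemma sum_bool_card (T : finType) (P : pred T) :
  \sum_x (P x : nat) = #|[set x | P x]|.
Proof.
rewrite cardsE -sum1_card [RHS]big_mkcond; apply: eq_bigr => x _.
by rewrite unfold_in; case: (P x).
Qed.

(** Mantel's theorem with its equality case, for degree sums (twice the number
    of edges).  Take for [A] the neighbours of a vertex of maximal degree
    [#|A|].  No edge lies inside [A], so every edge has an end in [~: A], and
    the degrees over [~: A] add up to at most [#|A| * #|~: A|].  In the equality
    case no edge is counted twice, so [~: A] is independent, and each of its
    vertices has [#|A|] neighbours, all in [A]. *)
Lemma triangle_free_degree_sum (T : finType) (e : rel T) :
    symmetric e -> (forall x y z, e x y -> e y z -> ~~ e x z) ->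
  exists A : {set T},
    (\sum_x #|[set y | e x y]| <= 2 * (#|A| * #|~: A|))%N /\
    ((2 * (#|A| * #|~: A|) <= \sum_x #|[set y | e x y]|)%N ->
       forall x y, e x y = ((x \in A) != (y \in A))).
Proof.
move=> esym etri; set d := fun x => #|[set y | e x y]|.
have [noT|[x0 _]] := set_0Vmem [set: T].
  exists set0; have noel (x : T) : False by have := in_setT x; rewrite noT inE.
  by split=> [|_ x]; [rewrite big1 // => x; case: (noel x) | case: (noel x)].
case: (arg_maxnP d (isT : xpredT x0)) => v _ dmax.
pose A := [set y | e v y].
have Aind x y : x \in A -> y \in A -> e x y = false.
  rewrite !inE => vx vy; apply/negbTE; apply: etri vy.
  by rewrite esym.
have cnt (P : pred T) : \sum_(x | P x) d x = \sum_(x | P x) \sum_y (e x y : nat).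
  by apply: eq_bigr => x _; rewrite sum_bool_card.
have splitB : \sum_(x in ~: A) d x =
    \sum_(x in ~: A) \sum_(y in A) (e x y : nat)
    + \sum_(x in ~: A) \sum_(y in ~: A) (e x y : nat).
  rewrite cnt -big_split /=; apply: eq_bigr => x _.
  by rewrite (bigID (mem A)) /=; congr (_ + _)%N; apply: eq_bigl => y; rewrite in_setC.
have sumA : \sum_(x in A) d x = \sum_(x in ~: A) \sum_(y in A) (e x y : nat).
  rewrite cnt exchange_big (bigID (mem A)) /= big1 => [|y yA]; last first.
    by rewrite big1 // => x xA; rewrite Aind.
  rewrite add0n.
  apply: eq_big => [y|y _]; first by rewrite in_setC.
  by apply: eq_bigr => x _; rewrite esym.
have sumT : \sum_x d x = (\sum_(x in A) d x + \sum_(x in ~: A) d x)%N.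
  by rewrite (bigID (mem A)) /=; congr (_ + _)%N; apply: eq_bigl => y; rewrite in_setC.
have leB : (\sum_(x in ~: A) d x <= #|A| * #|~: A|)%N.
  rewrite mulnC -sum_nat_const; apply: leq_sum => x _; exact: dmax.
exists A; split; first by rewrite -[leqLHS]/(\sum_x d x) sumT; lia.
move=> ge2.
have ge2' : (2 * (#|A| * #|~: A|) <= \sum_x d x)%N by [].
(* The total is twice the degree sum over [~: A], minus this quantity. *)
have B0 : \sum_(x in ~: A) \sum_(y in ~: A) (e x y : nat) = 0%N by lia.
have eqB : \sum_(x in ~: A) d x = \sum_(x in ~: A) #|A|.
  rewrite sum_nat_const; lia.
have Bind x y : x \notin A -> y \notin A -> e x y = false.
  rewrite -!in_setC => xA yA; apply/negbTE/negP => exy; move: B0.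
  by rewrite (bigD1 x) //= (bigD1 y) //= exy.
have nbr x : x \notin A -> [set y | e x y] = A.
  move=> xA; apply/eqP; rewrite eqEcard; apply/andP; split.
    apply/subsetP => y; rewrite inE => exy; apply/negPn/negP => yA.
    by rewrite Bind in exy.
  rewrite leqNgt; apply/negP => lt.
  have xB : x \in ~: A by rewrite in_setC.
  move: eqB; rewrite (bigD1 x) //= [RHS](bigD1 x) //= => eqB.
  have : \sum_(i in ~: A | i != x) d i <= \sum_(i in ~: A | i != x) #|A|.
    by apply: leq_sum => y _; apply: dmax.
  have : d x < #|A| by [].
  lia.
move=> x y; case xA: (x \in A); case yA: (y \in A) => /=.
- exact: Aind.
- by rewrite esym; move/negbT/nbr/setP/(_ x): yA; rewrite inE xA.
- by move/negbT/nbr/setP/(_ y): xA; rewrite inE yA.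
- by apply: Bind; rewrite ?xA ?yA.
Qed.

(** * Permutations and their ascending pairs *)

Lemma card_ord_lt n k : (k <= n)%N -> #|[set x : 'I_n | (x < k)%N]| = k.
Proof.
move=> kn; have inj : injective (widen_ord kn).
  by move=> x y /(congr1 val) /= /val_inj.
rewrite -[RHS]card_ord -(card_imset _ inj).
apply: eq_card => x; rewrite !inE; apply/idP/imsetP => [xk|[y _ ->]]; last first.
  by rewrite /= ltn_ord.
by exists (Ordinal xk) => //; apply: val_inj.
Qed.

Lemma downset_ord n (D : {set 'I_n}) :
    (forall x y : 'I_n, (x < y)%N -> y \in D -> x \in D) ->
  forall x, (x \in D) = (x < #|D|)%N.
Proof.
move=> down x; apply/idP/idP => [xD|].
  rewrite -(card_ord_lt (ltn_ord x)); apply: subset_leq_card.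
  apply/subsetP => y; rewrite inE ltnS leq_eqVlt => /orP[/eqP/val_inj->//|yx].
  exact: down yx xD.
apply: contraLR => xD; rewrite -leqNgt -[leqRHS](card_ord_lt (ltnW (ltn_ord x))).
apply: subset_leq_card; apply/subsetP => y yD; rewrite inE ltnNge leq_eqVlt.
apply/negP => /orP[/eqP/val_inj xy|/down/(_ yD)]; last exact/negP.
by rewrite xy yD in xD.
Qed.

Lemma perm_eq_of_ascents n (s t : 'S_n) :
    (forall x y : 'I_n, (x < y)%N -> (s x < s y)%N = (t x < t y)%N) -> s = t.
Proof.
move=> asc.
have asc' x y : (s x < s y)%N = (t x < t y)%N.
  case: (ltngtP x y) => [|yx|/val_inj->]; [exact: asc| |by rewrite !ltnn].
  have neq (u : 'S_n) : (u x < u y)%N = ~~ (u y < u x)%N.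
    rewrite -leqNgt [RHS]leq_eqVlt; case: eqP => // /val_inj/perm_inj xy.
    by rewrite xy ltnn in yx.
  by rewrite !neq asc.
have rank (u : 'S_n) x : #|[set y | (u y < u x)%N]| = u x.
  rewrite -[RHS](card_ord_lt (ltnW (ltn_ord (u x)))) -(card_imset _ (@perm_inj _ u)).
  apply: eq_card => z; rewrite !inE; apply/imsetP/idP => [[y]|zx].
    by rewrite inE => + ->.
  by exists (u^-1%g z); rewrite ?inE permKV.
apply/permP => x; apply: val_inj; rewrite /= -rank -[RHS]rank.
by apply: eq_card => y; rewrite !inE asc'.
Qed.

(** * The Hasse diagram of a permutation *)

Definition below n (s : 'S_n) (x y : 'I_n) : bool := (x < y)%N && (s x < s y)%N.

Definition cover_adj n (s : 'S_n) (x y : 'I_n) : bool :=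
  box12_occ s x y || box12_occ s y x.

Lemma box12_occP n (s : 'S_n) x y :
  reflect (below s x y /\ forall z, below s x z -> ~~ below s z y)
          (box12_occ s x y).
Proof.
rewrite /box12_occ /below; apply: (iffP and3P) => [[-> -> /existsPn nz]|[/andP[-> ->] nz]].
  split=> // z /andP[xz sxz]; have := nz z; by rewrite xz sxz.
split=> //; apply/existsPn => z; apply/negP => /andP[/andP[xz zy] /andP[sxz szy]].
by have := nz z; rewrite xz zy sxz szy => /(_ isT).
Qed.

Lemma below_trans n (s : 'S_n) y x z : below s x y -> below s y z -> below s x z.
Proof. by move=> /andP[a b] /andP[c d]; rewrite /below (ltn_trans a c) (ltn_trans b d). Qed.

Lemma below_asym n (s : 'S_n) x y : below s x y -> ~~ below s y x.
Proof. by move=> /andP[a _]; apply/negP => /andP[b _]; lia. Qed.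

Lemma adj_sym n (s : 'S_n) : symmetric (cover_adj s).
Proof. by move=> x y; rewrite /cover_adj orbC. Qed.

Lemma adj_below n (s : 'S_n) x y : cover_adj s x y -> below s x y || below s y x.
Proof. by case/orP => /box12_occP[-> _]; rewrite ?orbT. Qed.

Lemma adj_not_between n (s : 'S_n) x y z :
  below s x y -> below s y z -> ~~ cover_adj s x z.
Proof.
move=> xy yz; apply/negP => /orP[/box12_occP[_ /(_ _ xy)]|/box12_occP[zx _]].
  by rewrite yz.
by have := below_asym (below_trans xy yz); rewrite zx.
Qed.

Lemma adj_triangle_free n (s : 'S_n) x y z :
  cover_adj s x y -> cover_adj s y z -> ~~ cover_adj s x z.
Proof.
move=> xy yz; apply/negP => xz.
have nb a b c : below s a b -> below s b c -> cover_adj s a c -> False.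
  by move=> ab bc; apply/negP/(adj_not_between ab bc).
have [zx zy yx] : [/\ cover_adj s z x, cover_adj s z y & cover_adj s y x].
  by split; rewrite adj_sym.
case/orP: (adj_below xy) => a; case/orP: (adj_below yz) => b;
  case/orP: (adj_below xz) => c; first [exact: nb a b _ | exact: nb b a _
  | exact: nb a c _ | exact: nb c a _ | exact: nb b c _ | exact: nb c b _ ].
Qed.

Lemma adj_degree_sum n (s : 'S_n) :
  \sum_x #|[set y | cover_adj s x y]| = (2 * box12_count s)%N.
Proof.
have -> : box12_count s = \sum_x \sum_y (box12_occ s x y : nat).
  by rewrite /box12_count -sum_bool_card pair_big.
rewrite mul2n -addnn [X in (_ + X)%N]exchange_big -big_split; apply: eq_bigr => x _ /=.
rewrite -big_split -sum_bool_card; apply: eq_bigr => y _ /=.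
rewrite /cover_adj; case: (boolP (box12_occ s x y)) => [/box12_occP[xy _]|_] /=.
  case: (boolP (box12_occ s y x)) => [/box12_occP[yx _]|_] //=.
  by have := below_asym xy; rewrite yx.
by [].
Qed.

Lemma mul_compl_le n k : (k <= n)%N -> (k * (n - k) <= n ^ 2 %/ 4)%N.
Proof. move=> kn; rewrite leq_divRL // mulnC -{2}(subnKC kn).
exact: (nat_AGM2 k (n - k)).1. Qed.

Lemma card_setC_ord n (A : {set 'I_n}) : #|~: A| = (n - #|A|)%N.
Proof. by rewrite cardsCs setCK card_ord. Qed.

Lemma box12_count_le n (s : 'S_n) : (box12_count s <= n ^ 2 %/ 4)%N.
Proof.
have [A []] := triangle_free_degree_sum (@adj_sym n s) (@adj_triangle_free n s).
rewrite adj_degree_sum leq_pmul2l // => le _; apply: leq_trans le _.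
rewrite card_setC_ord; apply: mul_compl_le.
by rewrite -[leqRHS]card_ord max_card.
Qed.

Lemma extremal_bipartition n (s : 'S_n) : box12_count s = (n ^ 2 %/ 4)%N ->
  exists2 A : {set 'I_n}, (#|A| * (n - #|A|) = n ^ 2 %/ 4)%N &
    forall x y, cover_adj s x y = ((x \in A) != (y \in A)).
Proof.
move=> bs.
have [A []] := triangle_free_degree_sum (@adj_sym n s) (@adj_triangle_free n s).
rewrite adj_degree_sum !leq_pmul2l // card_setC_ord bs => le eq.
have leA : (#|A| <= n)%N by rewrite -[leqRHS]card_ord max_card.
have ge := mul_compl_le leA.
by exists A; [apply/eqP; rewrite eqn_leq ge | exact: eq].
Qed.

(** * Extremal permutations are layered *)

(** The index 0, 1 or 2 of the block containing [x] when the positions are cut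
    before [f] and before [g]. *)
Definition layer (f g x : nat) : nat := (f <= x) + (g <= x).

(** In the Hasse diagram of an extremal [s], which is complete bipartite, [A] is
    the side that avoids position 0.  An element outside [A] that is above one
    element of [A] is above all of them: being above one, it is above 0, and if
    it were below another one, it would separate that one from 0.  The layers
    are therefore the lower part [C] of the complement of [A], then [A], then
    the rest.  Each layer is an antichain, as two comparable elements of a layer
    would break a covering relation with an element on the other side.  Since
    [s] has no descent between layers, the layers are intervals of positions. *)
Lemma extremal_layers n (s : 'S_n) : 0 < n -> box12_count s = n ^ 2 %/ 4 ->
  exists f g, [/\ 0 < f <= g, g <= n, (g - f) * (n - (g - f)) = n ^ 2 %/ 4 &
    forall x y : 'I_n, x < y -> (s x < s y) = (layer f g x < layer f g y)].
Proof.
move=> n0 /extremal_bipartition[A0 cA0 adjA0]; pose z0 := Ordinal n0.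
have [A [z0A cA adjA]] : exists A : {set 'I_n},
    [/\ z0 \notin A, #|A| * (n - #|A|) = n ^ 2 %/ 4 &
        forall x y, cover_adj s x y = ((x \in A) != (y \in A))].
  case: (boolP (z0 \in A0)) => z0A; last by exists A0.
  exists (~: A0); split; first by rewrite inE z0A.
    have leA : #|A0| <= n by rewrite -[leqRHS]card_ord max_card.
    by rewrite card_setC_ord subKn // mulnC.
  by move=> x y; rewrite adjA0 !inE; case: (x \in A0); case: (y \in A0).
have z0min a : a \in A -> below s z0 a.
  move=> aA; have /adj_below/orP[//|/andP[]//] : cover_adj s z0 a.
  by rewrite adjA aA (negbTE z0A).
have cmp z a : z \notin A -> a \in A -> below s z a || below s a z.
  by move=> zA aA; apply: adj_below; rewrite adjA aA (negbTE zA).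
pose C := [set z | (z \notin A) && [forall a in A, below s z a]].
have C_below z a : z \in C -> a \in A -> below s z a.
  by rewrite inE => /andP[_ /forall_inP H]; apply: H.
have C_notA z : z \in C -> z \notin A by rewrite inE => /andP[].
have upper z : z \notin A -> z \notin C ->
    (exists a, a \in A) /\ forall a, a \in A -> below s a z.
  move=> zA; rewrite inE zA /= => /forall_inPn[a0 a0A nza0].
  split=> [|a aA]; first by exists a0.
  case/orP: (cmp z a zA aA) => // za; case/orP: (cmp z a0 zA a0A) => [|a0z].
    by rewrite (negbTE nza0).
  have /negP[] := adj_not_between (below_trans (z0min _ a0A) a0z) za.
  by rewrite adjA aA (negbTE z0A).
pose L z := (z \notin C) + (z \notin A :|: C).
have L_C z : z \in C -> L z = 0 by move=> zC; rewrite /L in_setU zC orbT.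
have L_A z : z \in A -> L z = 1.
  move=> zA; rewrite /L in_setU zA /=; case: (boolP (z \in C)) => // /C_notA.
  by rewrite zA.
have L_U z : z \notin A -> z \notin C -> L z = 2.
  by move=> zA zC; rewrite /L in_setU (negbTE zA) zC.
have L_below x y : L x < L y -> below s x y.
  case: (boolP (x \in A)) => xA; case: (boolP (y \in A)) => yA.
  - by rewrite !L_A.
  - case: (boolP (y \in C)) => yC; first by rewrite (L_C y).
    by move=> _; have [_] := upper y yA yC; apply.
  - case: (boolP (x \in C)) => xC; first by move=> _; apply: C_below.
    by rewrite (L_A y) // L_U.
  - case: (boolP (y \in C)) => yC; first by rewrite (L_C y).
    case: (boolP (x \in C)) => xC; last by rewrite !L_U.
    have [[a aA] ay] := upper y yA yC => _.
    by apply: (below_trans (C_below x a xC aA)); apply: ay.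
(* If [A] is empty, there is no edge, so [n ^ 2 %/ 4 = 0]. *)
have n_le1 : (forall a, a \notin A) -> n <= 1.
  move=> A_empty; have A0E : A = set0 by apply/setP => z; rewrite inE (negbTE (A_empty z)).
  move: cA; rewrite A0E cards0 mul0n => /esym/eqP.
  by rewrite -leqn0 leqNgt divn_gt0 // -leqNgt; case: (n) => [|[|m]] //; nia.
have L_anti x y : L x = L y -> ~~ below s x y.
  move=> Lxy; apply/negP => xy; have adjN := adj_not_between xy.
  have adjN' z := @adj_not_between n s z x y ^~ xy.
  case: (boolP (x \in A)) Lxy => xA; case: (boolP (y \in A)) => yA.
  - by have := adjN' _ (z0min x xA); rewrite adjA yA (negbTE z0A).
  - rewrite L_A //; case: (boolP (y \in C)) => yC; first by rewrite L_C.
    by rewrite L_U.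
  - rewrite (L_A y) //; case: (boolP (x \in C)) => xC; first by rewrite L_C.
    by rewrite L_U.
  - case: (boolP (x \in C)) => xC; case: (boolP (y \in C)) => yC.
    + move=> _; have [a /= aA|A_empty] := pickP [pred a | a \in A]; last first.
        have := n_le1 (fun a => negbT (A_empty a)).
        by move: xy => /andP[xy _]; have := ltn_ord y; lia.
      by have := adjN _ (C_below y a yC aA); rewrite adjA aA (negbTE xA).
    + by rewrite L_C // L_U.
    + by rewrite L_U // L_C.
    + have [[a aA] /(_ a aA) ax] := upper x xA xC.
      by have := adjN' _ ax; rewrite adjA aA (negbTE yA).
have down (k : nat) (x y : 'I_n) : x < y -> L y < k -> L x < k.
  move=> xy Ly; rewrite ltnNge; apply/negP => Lx.
  have /andP[] : below s y x by apply/L_below/(leq_trans Ly).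
  by rewrite ltnNge (ltnW xy).
have C_L z : (z \in C) = (L z < 1).
  by rewrite /L in_setU; case: (z \in C); rewrite ?orbT.
have AC_L z : (z \in A :|: C) = (L z < 2).
  by rewrite /L in_setU; case: (z \in C); case: (z \in A).
have C_ord : forall x, (x \in C) = (x < #|C|).
  by apply: downset_ord => x y xy; rewrite !C_L; apply: down.
have AC_ord : forall x, (x \in A :|: C) = (x < #|A :|: C|).
  by apply: downset_ord => x y xy; rewrite !AC_L; apply: down.
have cardAC : #|A :|: C| = #|A| + #|C|.
  have disj : [disjoint A & C].
    by rewrite disjoint_sym disjoint_subset; apply/subsetP => z /C_notA.
  by apply/eqP; rewrite -(leq_card_setU A C).2 in disj *.
exists #|C|, #|A :|: C|; split.
- rewrite cardAC leq_addl andbT; apply/card_gt0P; exists z0.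
  by rewrite inE z0A; apply/forall_inP.
- by rewrite -[leqRHS]card_ord max_card.
- by rewrite cardAC addnK.
move=> x y xy; have LE (z : 'I_n) : layer #|C| #|A :|: C| z = L z.
  by rewrite /layer /L C_ord AC_ord (leqNgt #|C|) (leqNgt #|_ :|: _|).
rewrite !LE; have -> : (s x < s y) = below s x y by rewrite /below xy.
apply/idP/idP => [bxy|]; last exact: L_below.
case: (ltngtP (L x) (L y)) => // [/L_below yx|/L_anti]; last by rewrite bxy.
by have := below_asym bxy; rewrite yx.
Qed.

(** * Sums of three decreasing blocks *)

(** Reverses each of the intervals [[0, f)], [[f, g)], [[g, n)] in place. *)
Definition blockwise_rev n f g (x : nat) : nat :=
  if x < f then f - x.+1
  else if x < g then f + g - x.+1
  else g + n - x.+1.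

Lemma blockwise_rev_lt n f g (x : 'I_n) : f <= g <= n -> blockwise_rev n f g x < n.
Proof.
have := ltn_ord x; rewrite /blockwise_rev.
by case: (ltnP x f); case: (ltnP x g); lia.
Qed.

Lemma blockwise_revK n f g (x : 'I_n) : f <= g <= n ->
  blockwise_rev n f g (blockwise_rev n f g x) = x.
Proof.
have := ltn_ord x; rewrite /blockwise_rev.
by case: (ltnP x f) => xf; [|case: (ltnP x g) => xg]; do ![case: ltnP => ?]; lia.
Qed.

Lemma layered_inj n f g (fgn : f <= g <= n) :
  injective (fun x : 'I_n => Ordinal (blockwise_rev_lt x fgn)).
Proof.
apply: inv_inj => x; apply: val_inj; exact: blockwise_revK.
Qed.

Definition layered n f g (fgn : f <= g <= n) : 'S_n := perm (@layered_inj n f g fgn).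

Lemma layeredE n f g (fgn : f <= g <= n) x :
  layered fgn x = blockwise_rev n f g x :> nat.
Proof. by rewrite permE. Qed.

Lemma layered_ascent n f g (fgn : f <= g <= n) (x y : 'I_n) : x < y ->
  (layered fgn x < layered fgn y) = (layer f g x < layer f g y).
Proof.
rewrite !layeredE /blockwise_rev /layer; have := ltn_ord x; have := ltn_ord y.
move: fgn (x : nat) (y : nat) => /andP[fg gn] {}x {}y.
by case: (leqP f x); case: (leqP f y); case: (leqP g x); case: (leqP g y) => /=; lia.
Qed.

Lemma card_block n f g : f <= g <= n -> #|[set x : 'I_n | f <= x < g]| = g - f.
Proof.
move=> /andP[fg gn]; rewrite -[in RHS](card_ord_lt gn) -[X in _ - X](card_ord_lt (leq_trans fg gn)).
rewrite -cardsDS; last by apply/subsetP => x; rewrite !inE => /leq_trans; apply.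
by apply: eq_card => x; rewrite !inE -leqNgt.
Qed.

(** The middle block [M] is joined by a covering relation to everything outside
    [M]: an element strictly between [x] and [y] would force [x] and [y] into the
    first and the last layer. *)
Lemma layered_extremal n f g (fgn : f <= g <= n) :
  (g - f) * (n - (g - f)) = n ^ 2 %/ 4 -> box12_count (layered fgn) = n ^ 2 %/ 4.
Proof.
move=> opt; apply/eqP; rewrite eqn_leq box12_count_le -opt /=.
set s := layered fgn; pose M := [set x : 'I_n | f <= x < g].
have occ x y : (x \in M) != (y \in M) -> x < y -> box12_occ s x y.
  rewrite !inE => Mxy xy; apply/box12_occP; split.
    by rewrite /below xy layered_ascent // /layer; move: Mxy; lia.
  move=> z /andP[xz]; rewrite layered_ascent // => sxz; apply/negP => /andP[zy].
  by rewrite layered_ascent // => szy; move: Mxy sxz szy; rewrite /layer; lia.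
have adj x y : (x \in M) != (y \in M) -> cover_adj s x y.
  move=> Mxy; rewrite /cover_adj; case: (ltngtP x y) => [xy|yx|/val_inj xy].
  - by rewrite occ.
  - by rewrite (occ y x) ?orbT // eq_sym.
  - by rewrite xy eqxx in Mxy.
rewrite -(leq_pmul2l (isT : 0 < 2)) -adj_degree_sum -(card_block fgn) -/M.
rewrite (bigID (mem M)) /= mul2n -addnn; apply: leq_add.
  rewrite -sum_nat_const; apply: leq_sum => x xM; rewrite -card_setC_ord.
  apply: subset_leq_card; apply/subsetP => y; rewrite in_setC => yM.
  by rewrite inE; apply: adj; rewrite xM (negbTE yM).
rewrite mulnC -card_setC_ord -sum_nat_const.
have -> : \sum_(i in ~: M) #|M| = \sum_(i | i \notin M) #|M|.
  by apply: eq_bigl => x; rewrite in_setC.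
apply: leq_sum => x xM; apply: subset_leq_card; apply/subsetP => y yM.
by rewrite inE; apply: adj; rewrite yM (negbTE xM).
Qed.

(** * Counting the balanced break points *)

(** The break points [f] and [g] of an extremal permutation satisfy
    [g - f = n./2], or for odd [n] also [g - f = n./2.+1].  For even [n] they are
    listed by increasing [f].  For odd [n] they are listed by increasing [f + g],
    which takes each value of an interval of length [n] exactly once: a step
    increases alternately [g] and [f]. *)
Definition first_break n (t : nat) : nat := (if odd n then t./2 else t).+1.
Definition second_break n (t : nat) : nat := first_break n t + n./2 + (odd n && odd t).
Definition num_extremal n : nat := if odd n then n else n./2.

Lemma breaks_le n (t : 'I_(num_extremal n)) : first_break n t <= second_break n t <= n.
Proof.
have := ltn_ord t; rewrite /num_extremal /second_break /first_break; move: (t : nat) => {}t.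
by case: (boolP (odd n)) => on; lia.
Qed.

Definition extremal_perm n (t : 'I_(num_extremal n)) : 'S_n := layered (breaks_le t).

Lemma sqr_div4 n : n ^ 2 %/ 4 = n./2 * uphalf n.
Proof.
rewrite uphalf_half -{1}(odd_double_half n); set m := n./2.
case: (odd n) => /=; rewrite -mul2n.
  have -> : (1 + 2 * m) ^ 2 = (m * (1 + m)) * 4 + 1 by ring.
  by rewrite divnMDl // divn_small // addn0.
have -> : (0 + 2 * m) ^ 2 = (m * (0 + m)) * 4 by ring.
by rewrite mulnK.
Qed.

Lemma breaks_balanced n (t : 'I_(num_extremal n)) :
  let a := second_break n t - first_break n t in a * (n - a) = n ^ 2 %/ 4.
Proof.
rewrite /= /second_break -addnA addKn sqr_div4 uphalf_half.
rewrite -[X in X - _](odd_double_half n) -mul2n.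
move: (odd n) (odd t) (n./2) => [] [] m /=.
- by rewrite mulnC; congr (_ * _); lia.
- by congr (_ * _); lia.
- by congr (_ * _); lia.
- by congr (_ * _); lia.
Qed.

Lemma balanced_breaks n f g : 0 < n -> 0 < f <= g -> g <= n ->
    (g - f) * (n - (g - f)) = n ^ 2 %/ 4 ->
  exists t : 'I_(num_extremal n), first_break n t = f /\ second_break n t = g.
Proof.
move=> n0 /andP[f0 fg] gn; rewrite sqr_div4 uphalf_half => prod.
have {}prod : g - f = n./2 \/ g - f = odd n + n./2.
  have en := odd_double_half n; move: prod en; rewrite -mul2n.
  move: (n./2) (odd n : nat) (g - f) (leq_subr f g) => m o a ag prod en.
  (* [a * (n - a)] takes the value [m * (m + o)], where [n = 2 * m + o], only at
     the two roots [m] and [m + o] of a quadratic equation. *)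
  have E : ((a%:Z - m%:Z) * (a%:Z - (o + m)%:Z) = 0)%R by nia.
  by move/eqP: E; rewrite mulf_eq0 !subr_eq0 => /orP[]/eqP[->]; [left|right].
rewrite /num_extremal /second_break /first_break; case: (boolP (odd n)) prod => on /= prod.
  (* The parity of the index tells which of the two middle sizes occurs. *)
  have tn : f.-1.*2 + (g - f != n./2) < n by lia.
  by exists (Ordinal tn) => /=; lia.
have tn : f.-1 < n./2 by lia.
by exists (Ordinal tn) => /=; lia.
Qed.

(** The value at position 0 reveals the first break point, and the value at the
    first break point, the start of the middle block, reveals the second one.
    For [n = 1] the middle block is empty, but there is only one index. *)
Lemma extremal_perm_inj n : injective (@extremal_perm n).
Proof.
move=> t u tu; have small (v : 'I_(num_extremal n)) : v < n /\ (n <= 1 -> v = 0 :> nat).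
  have := ltn_ord v; rewrite {2}/num_extremal; move: (v : nat) => {}v.
  by case: (odd n); lia.
have [tn t0] := small t; have [_ u0] := small u.
have bt := breaks_le t; have bu := breaks_le u.
have E (x : 'I_n) : blockwise_rev n (first_break n t) (second_break n t) x =
    blockwise_rev n (first_break n u) (second_break n u) x.
  by have := congr1 (fun s : 'S_n => s x : nat) tu; rewrite !layeredE.
apply: val_inj => /=.
have n0 : 0 < n by apply: leq_ltn_trans tn.
(* Both permutations send 0 to the end of their first block. *)
have eqf : first_break n t = first_break n u.
  by have := E (Ordinal n0); rewrite /blockwise_rev /first_break /= !subSS !subn0 => ->.
have [n1|n1] := leqP n 1; first by rewrite t0 ?u0.
have fn : first_break n t < n by move: bt; rewrite /second_break; lia.
have fg : first_break n t < second_break n t by rewrite /second_break; lia.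
have fg' : first_break n t < second_break n u by rewrite /second_break eqf; lia.
have := E (Ordinal fn); rewrite /blockwise_rev /= -eqf ltnn fg fg' => eqg.
have {}eqg : second_break n t = second_break n u by lia.
have {eqg} : odd n -> odd t = odd u.
  move: eqg; rewrite /second_break eqf => /addnI.
  by case: (odd n) (odd t) (odd u) => [] [] [].
by move: eqf; rewrite /first_break; case: (odd n); lia.
Qed.

Lemma card_extremal_perms n : 0 < n ->
  #|[set s : 'S_n | box12_count s == n ^ 2 %/ 4]| = num_extremal n.
Proof.
move=> n0; rewrite -[RHS]card_ord -(card_imset _ (@extremal_perm_inj n)).
apply: eq_card => s; rewrite inE; apply/eqP/imsetP => [bs|[t _ ->]]; last first.
  by apply: layered_extremal; apply: breaks_balanced.
have [f [g [fg gn prod asc]]] := extremal_layers n0 bs.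
have [t [tf tg]] := balanced_breaks n0 fg gn prod.
exists t => //; apply: perm_eq_of_ascents => x y xy.
by rewrite asc // layered_ascent // tf tg.
Qed.

(** * Pairs of consecutive values in a window *)

Definition succ_in n (W : {set 'I_n}) (s : 'S_n) (a b : 'I_n) : bool :=
  (s a < s b) && ~~ [exists k in W, s a < s k < s b].

(** Each position of the window, except the one with the largest value, has
    exactly one successor. *)
Lemma sum_succ_in n (W : {set 'I_n}) (s : 'S_n) :
  \sum_(a in W) \sum_(b in W) succ_in W s a b = #|W|.-1.
Proof.
have [->|[w0 w0W]] := set_0Vmem W; first by rewrite big_set0 cards0.
case: (arg_maxnP (fun x => s x : nat) w0W) => m mW mmax.
have {}mW : m \in W by [].
have {}mmax b : b \in W -> s b <= s m by apply: mmax.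
have sum_m : \sum_(b in W) (succ_in W s m b : nat) = 0.
  by apply: big1 => b bW; rewrite /succ_in ltnNge (mmax b bW).
have sum_a a : a \in W -> a != m -> \sum_(b in W) (succ_in W s a b : nat) = 1.
  move=> aW am; have am' : (m \in W) && (s a < s m).
    rewrite mW ltn_neqAle (mmax a aW) andbT; apply: contraNneq am.
    by move=> /val_inj/perm_inj->.
  case: (@arg_minnP _ m (fun b => (b \in W) && (s a < s b)) (fun b => s b : nat) am').
  move=> b /andP[bW ab] bmin; rewrite (bigD1 b) //= big1 => [|c /andP[cW cb]].
    rewrite /succ_in ab /=; case: exists_inP => // -[k kW /andP[ak kb]].
    by have := bmin k; rewrite kW ak leqNgt kb => /(_ isT).
  rewrite /succ_in; case: (boolP (s a < s c)) => //= ac.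
  case: exists_inP => // -[]; exists b => //; rewrite ab ltn_neqAle bmin ?cW //.
  by rewrite andbT; apply: contraNneq cb => /val_inj/perm_inj->.
rewrite (bigD1 m) //= sum_m add0n (cardsD1 m) mW -sum1_card.
apply: eq_big => [a|a /andP[aW am]]; last exact: sum_a.
by rewrite in_setD1 andbC.
Qed.

Lemma succ_in_conj n (W : {set 'I_n}) (t s : 'S_n) a b :
  (forall x, (t x \in W) = (x \in W)) ->
  succ_in W (t * s)%g a b = succ_in W s (t a) (t b).
Proof.
move=> tW; rewrite /succ_in !permM; congr (_ && ~~ _).
apply/exists_inP/exists_inP => -[k kW kP].
  by exists (t k); rewrite ?tW //; rewrite permM in kP.
by exists (t^-1%g k); [rewrite -tW permKV | rewrite permM permKV].
Qed.

Lemma tperm_stab n (W : {set 'I_n}) a b x : a \in W -> b \in W ->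
  (tperm a b x \in W) = (x \in W).
Proof. by move=> aW bW; case: tpermP => [->|->|//]; rewrite aW bW. Qed.

(** Composition with a product of two transpositions inside [W] moves [(i, j)]
    to [(a, b)]. *)
Lemma card_succ_in_const n (W : {set 'I_n}) i j a b :
    i \in W -> j \in W -> a \in W -> b \in W -> i != j -> a != b ->
  #|[set s : 'S_n | succ_in W s a b]| = #|[set s : 'S_n | succ_in W s i j]|.
Proof.
move=> iW jW aW bW ij ab; set c := tperm i a j.
have cW : c \in W by rewrite tperm_stab.
pose t : 'S_n := (tperm i a * tperm c b)%g.
have tW x : (t x \in W) = (x \in W) by rewrite permM !tperm_stab.
have ti : t i = a.
  rewrite permM tpermL tpermD //; last by rewrite eq_sym.
  apply: contraNneq ij => ca.
  by rewrite -(inj_eq (@perm_inj _ (tperm i a))) tpermL -/c ca.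
have tj : t j = b by rewrite permM -/c tpermL.
rewrite -(card_imset _ (mulgI t)); apply: eq_card => s; rewrite inE.
apply/imsetP/idP => [[u]|su].
  by rewrite inE => su ->; rewrite succ_in_conj // ti tj.
by exists (t^-1 * s)%g; rewrite ?mulKVg // inE -ti -tj -succ_in_conj // mulKVg.
Qed.

(** Double counting of the triples [(s, a, b)] with [succ_in W s a b]. *)
Lemma card_succ_in n (W : {set 'I_n}) i j : i \in W -> j \in W -> i != j ->
  #|[set s : 'S_n | succ_in W s i j]| * #|W| = n`!.
Proof.
move=> iW jW ij; set N := #|[set s : 'S_n | succ_in W s i j]|.
have W2 : 1 < #|W|.
  apply: (@leq_trans #|[set i; j]|); first by rewrite cards2 ij.
  by apply/subset_leq_card/subsetP => x; rewrite !inE => /orP[]/eqP->.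
have : \sum_(s : 'S_n) \sum_(a in W) \sum_(b in W) (succ_in W s a b : nat)
   = n`! * #|W|.-1.
  rewrite -card_Sn -sum_nat_const; apply: eq_big => // s _; exact: sum_succ_in.
rewrite exchange_big /=.
have -> : \sum_(a in W) \sum_(s : 'S_n) \sum_(b in W) (succ_in W s a b : nat)
   = \sum_(a in W) (#|W|.-1 * N).
  apply: eq_bigr => a aW; rewrite exchange_big (bigD1 a) //= big1 => [|s _]; last first.
    by rewrite /succ_in ltnn.
  rewrite add0n (cardsD1 a) aW /= -sum_nat_const.
  apply: eq_big => [b|b /andP[bW ba]]; first by rewrite in_setD1 andbC.
  rewrite -[RHS](card_succ_in_const iW jW aW bW ij) 1?eq_sym //.
  exact: sum_bool_card.
rewrite sum_nat_const mulnA [X in X * N]mulnC -mulnA mulnC => /eqP.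
by rewrite eqn_pmul2r; [rewrite mulnC => /eqP | lia].
Qed.

Lemma box12_occ_succ_in n (s : 'S_n) (i j : 'I_n) :
  box12_occ s i j = (i < j) && succ_in [set x : 'I_n | i <= x < j.+1] s i j.
Proof.
rewrite /box12_occ; congr (_ && (_ && ~~ _)).
apply/existsP/exists_inP => [[k /andP[/andP[ik kj] ks]]|[k]].
  by exists k => //; rewrite inE ltnS (ltnW ik) (ltnW kj).
rewrite inE ltnS => /andP[ik kj] ks; exists k; rewrite ks andbT !ltn_neqAle ik kj.
by rewrite !andbT; apply/andP; split; apply/negP => /eqP/val_inj E;
  move: ks; rewrite E ltnn ?andbF.
Qed.

Lemma card_box12_occ n (i j : 'I_n) : i < j ->
  #|[set s : 'S_n | box12_occ s i j]| * (j.+1 - i) = n`!.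
Proof.
move=> ij; have Wc : i <= j.+1 <= n by rewrite ltnW ?ltn_ord // ltnS ltnW.
rewrite -(card_block Wc) -(@card_succ_in _ [set x : 'I_n | i <= x < j.+1] i j); first congr (_ * _).
- by apply: eq_card => s; rewrite !inE box12_occ_succ_in ij.
- by rewrite inE leqnn ltnS ltnW.
- by rewrite inE ltnS leqnn ltnW.
- by apply: contraTneq ij => ->; rewrite ltnn.
Qed.

Local Open Scope ring_scope.

(** * The mean number of occurrences *)

Lemma harmonicS n : harmonic n.+1 = harmonic n + n.+1%:R^-1.
Proof. by rewrite /harmonic big_nat_recr. Qed.

Lemma sum_inv_dist (j : nat) :
  \sum_(i < j) (j.+1 - i)%:R^-1 = harmonic j.+1 - 1 :> rat.
Proof.
rewrite /harmonic big_add1 /= big_mkord big_ord_recl /= invr1 addrC addKr.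
rewrite (reindex_inj rev_ord_inj); apply: eq_bigr => i _ /=.
by congr (_%:R^-1); rewrite /bump /=; have := ltn_ord i; lia.
Qed.

Lemma sum_harmonic n :
  \sum_(j < n) (harmonic j.+1 - 1) = n.+1%:R * harmonic n - (2 * n)%:R.
Proof.
elim: n => [|n IHn]; first by rewrite big_ord0 /harmonic big_geq // mulr0 subrr.
rewrite big_ord_recr /= IHn harmonicS.
have : n.+1%:R != 0 :> rat by rewrite pnatr_eq0.
move: (harmonic n) => H; rewrite mulnS (natrD _ 2) (natrM _ 2) -!natr1 => n0.
by field.
Qed.

Lemma boxD_deriv1 n : (boxD n)^`().[1] = \sum_(s : 'S_n) (box12_count s)%:R.
Proof.
rewrite /boxD raddf_sum horner_sum; apply: eq_bigr => s _ /=.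
by rewrite derivXn hornerMn hornerXn expr1n.
Qed.

Lemma coef_boxD n m : (boxD n)`_m = #|[set s : 'S_n | box12_count s == m]|%:R.
Proof.
rewrite /boxD coef_sum -sum_bool_card natr_sum.
by apply: eq_bigr => s _; rewrite coefXn eq_sym.
Qed.

Lemma boxD_deriv1_mean n :
  (boxD n)^`().[1] / n`!%:R = n.+1%:R * harmonic n - (2 * n)%:R.
Proof.
have n0 : n`!%:R != 0 :> rat by rewrite pnatr_eq0 -lt0n fact_gt0.
have countE (s : 'S_n) :
    (box12_count s)%:R = \sum_(j < n) \sum_(i < n | (i < j)%N) (box12_occ s i j)%:R :> rat.
  rewrite /box12_count -sum_bool_card natr_sum.
  rewrite -(pair_bigA _ (fun i j : 'I_n => (box12_occ s i j)%:R)) /=.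
  rewrite exchange_big; apply: eq_bigr => j _; rewrite [RHS]big_mkcond /=.
  apply: eq_bigr => i _.
  by case: (boolP (box12_occ s i j)) => [/and3P[-> _ _]|_] //=; rewrite if_same.
rewrite boxD_deriv1 (eq_bigr _ (fun s _ => countE s)) exchange_big mulr_suml /=.
rewrite -sum_harmonic; apply: eq_bigr => j _; rewrite exchange_big mulr_suml /=.
rewrite -sum_inv_dist (big_ord_widen n (fun i => (j.+1 - i)%:R^-1)) ?(ltnW (ltn_ord j)) //.
apply: eq_bigr => i ij.
have -> : \sum_(s : 'S_n) (box12_occ s i j)%:R
    = #|[set s : 'S_n | box12_occ s i j]|%:R :> rat.
  by rewrite -sum_bool_card natr_sum.
have d0 : (j.+1 - i)%:R != 0 :> rat by rewrite pnatr_eq0 subn_eq0 -ltnNge ltnS ltnW.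
by apply: (canLR (mulfK n0)); rewrite -(card_box12_occ ij) natrM mulrC mulfK.
Qed.

Theorem corollary8p3 (n : nat) (hn : (1 <= n)%N) :
  [/\ size (boxD n) = (n ^ 2 %/ 4).+1,
      (boxD n)`_(n ^ 2 %/ 4) = (if odd n then n%:R else n%:R / 2%:R) &
      (boxD n)^`().[1] / n`!%:R = n.+1%:R * harmonic n - (2 * n)%:R].
Proof.
have top : (boxD n)`_(n ^ 2 %/ 4) = (num_extremal n)%:R.
  by rewrite coef_boxD card_extremal_perms.
split; last exact: boxD_deriv1_mean.
  apply/eqP; rewrite eqn_leq; apply/andP; split.
    apply/leq_sizeP => m; rewrite coef_boxD => lt_m.
    rewrite (_ : [set _ | _] = set0) ?cards0 //; apply/setP => s; rewrite !inE.
    by apply/negbTE; rewrite neq_ltn (leq_ltn_trans (box12_count_le s)).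
  rewrite ltnNge; apply/negP => /leq_sizeP/(_ _ (leqnn _))/eqP.
  by rewrite top pnatr_eq0 /num_extremal; case: (boolP (odd n)); lia.
rewrite top /num_extremal; case: (boolP (odd n)) => // n_even.
rewrite -[in RHS](odd_double_half n) (negbTE n_even) add0n -muln2 natrM.
by rewrite mulfK.
Qed.
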